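(* Let $X$ and $X'$ be connected graphs, and let $\mathcal Y$ and $\mathcal Y'$ be collections of pairwise disjoint subgraphs in $X$ and $X'$, respectively. Let $V$ be a normed vector space. Let $(f,f_\#)\colon(X,\mathcal Y)\to(X',\mathcal Y')$ be a relatively coarsely uniform map satisfying the following additional assumptions: (a) $f_\#$ is a bijection; (b) for every $Y\in\mathcal Y$ and every $x\in X$, we have $x\in Y$ if and only if $f(x)\in f_\#(Y)$; (c) there is a non-decreasing function $\rho_-\colon[0,\infty)\to[0,\infty)$, with $\rho_-(r)\to\infty$ as $r\to\infty$, such that, whenever $x_1,x_2\in X$ do not both belong to some common $Y\in\mathcal Y$, then $d(f(x_1),f(x_2))\ge\rho_-(d(x_1,x_2))$; (d) there is a non-decreasing function $\rho\colon[0,\infty)\to[0,\infty)$ such that, for every $Y\in\mathcal Y$, writing $Y'=f_\#(Y)$, and for every $y'\in Y'$ and $x'\in X'\setminus Y'$, there is some $y\in Y$ such that $d(y',f(y))\le\rho(d(y',x'))$. Moreover, assume that $X'=f(X)\cup\bigcup_{Y'\in\mathcal Y'}Y'$. Then, in any degree $k\ge0$, the pull-back map $f^*\colon H^k_{(\infty)}(X',\mathcal Y';V)\to H^k_{(\infty)}(X,\mathcal Y;V)$ is an isomorphism.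
   Context: A graph $X$ has vertex set $\mathcal V_X$ and path metric $d$ with edges of length $1$. Maps between graphs and points of graphs or subgraphs are understood at the level of vertices: $f$ is a map $\mathcal V_X\to\mathcal V_{X'}$ and $x\in X$, $y\in Y$ etc. refer to vertices. $C_i(X)$ is the real vector space with basis $\mathcal V_X^{i+1}$, with the $\ell^1$-norm, and $C_i^R(X)$ is the subspace spanned by tuples with pairwise distances at most $R$. $C^i_{(\infty)}(X;V)$ is the space of linear maps $\alpha\colon C_i(X)\to V$ with $\alpha|_{C_i^R(X)}$ bounded for every $R\in\mathbb N$, and $C^i_{(\infty)}(X,\mathcal Y;V)$ is the subspace of those $\alpha$ that vanish on $(\mathcal V_Y)^{i+1}$ for every $Y\in\mathcal Y$. With the usual simplicial coboundary these form a complex with cohomology $H^\bullet_{(\infty)}(X,\mathcal Y;V)$. A relatively coarsely uniform map $(f,f_\#)\colon(X,\mathcal Y)\to(X',\mathcal Y')$ is given by maps $f\colon X\to X'$ and $f_\#\colon\mathcal Y\to\mathcal Y'$ such that: (i) $f(Y)\subseteq f_\#(Y)$ for every $Y\in\mathcal Y$; (ii) there is a non-decreasing function $\rho_+\colon[0,\infty)\to[0,\infty)$ such that for all $x_1,x_2\in X$ either there is some $Y\in\mathcal Y$ with $x_1,x_2\in Y$, or $d(f(x_1),f(x_2))\le\rho_+(d(x_1,x_2))$. Such a map induces, via $f^*\alpha(x_0,\dots,x_k)=\alpha(f(x_0),\dots,f(x_k))$, a map $f^*$ in cohomology. *)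

(* Defs.v *)
From HB Require Import structures.
From mathcomp Require Import all_boot all_order all_algebra.
From mathcomp Require Import boolp classical_sets functions reals topology.
From mathcomp Require Import normedtype.
From mathcomp Require Import freeg zify.

Set Implicit Arguments.
Unset Strict Implicit.
Unset Printing Implicit Defensive.

Import Order.TTheory GRing.Theory Num.Theory.
Import numFieldNormedType.Exports.

Local Open Scope classical_set_scope.
Local Open Scope ring_scope.

(* Only the vertices and the path metric matter here, so a graph is a symmetric
   relation: loops are allowed, and parallel edges are not distinguished. *)
Record graph := Graph {
  vertex :> choiceType;
  adj : rel vertex;
  adj_sym : symmetric adj }.

Record subgraph (X : graph) := Subgraph {
  verts : set X;
  sadj : rel X;
  sadj_sym : symmetric sadj;
  sadj_adj : forall u v, sadj u v -> adj u v;
  sadj_verts : forall u v, sadj u v -> verts u }.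

Section Metric.
Variable X : graph.
Implicit Types x y z : X.

Definition walk (n : nat) x y :=
  exists p : seq X, [/\ path (@adj X) x p, last x p = y & size p = n].

Definition connected_graph := forall x y, exists n, walk n x y.

(* The value 0 for x and y in different components is a dummy. *)
Definition dist x y : nat :=
  match pselect (exists n, `[< walk n x y >]) with
  | left h => ex_minn h
  | right _ => 0%N
  end.

Lemma dist_walk x y : connected_graph -> walk (dist x y) x y.
Proof.
move=> cX; rewrite /dist; case: pselect => [h|[]].
  by case: ex_minnP => m /asboolP.
by have [n w] := cX x y; exists n; apply/asboolP.
Qed.

Lemma dist_le n x y : walk n x y -> (dist x y <= n)%N.
Proof.
move=> w; rewrite /dist; case: pselect => [h|//].
by case: ex_minnP => m _; apply; apply/asboolP.
Qed.

Lemma dist_triangle x y z : connected_graph ->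
  (dist x z <= dist x y + dist y z)%N.
Proof.
move=> cX; apply: dist_le.
have [p [pp lp sp]] := dist_walk x y cX.
have [q [pq lq sq]] := dist_walk y z cX.
by exists (p ++ q); rewrite cat_path last_cat size_cat pp lp pq lq sp sq.
Qed.

Lemma walk_sym n x y : walk n x y -> walk n y x.
Proof.
case=> p [pp lp sp]; exists (rev (belast x p)); split.
- by rewrite -lp rev_path; under eq_path do rewrite adj_sym.
- by rewrite -nth_last; case: p lp {pp sp} => [|a p] //= lp;
    rewrite rev_cons size_rcons /= nth_rcons ltnn eqxx.
- by rewrite size_rev size_belast.
Qed.

Lemma dist_sym x y : connected_graph -> dist x y = dist y x.
Proof.
move=> cX; apply/eqP; rewrite eqn_leq.
by apply/andP; split; apply/dist_le/walk_sym/dist_walk.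
Qed.

End Metric.

(* Functions R -> R standing for non-decreasing functions from [0, oo) to
   [0, oo); their values at negative arguments are irrelevant. *)
Definition control (R : realType) (rho : R -> R) :=
  (forall r, 0 <= r -> 0 <= rho r) /\
  (forall r s, 0 <= r -> r <= s -> rho r <= rho s).

Definition common (X : graph) (YY : set (subgraph X)) (x1 x2 : X) :=
  exists2 Y, YY Y & verts Y x1 /\ verts Y x2.

Section Fglift.
Variables (R : nzRingType) (K : choiceType) (M : lmodType R) (g : K -> M).

Lemma fglift_is_linear : linear (fglift g : {freeg K / R} -> M).
Proof.
have add := lift_is_additive g.
have l0 : fglift g 0 = 0 by rewrite -(subrr 0) add subrr.
have lD a b : fglift g (a + b) = fglift g a + fglift g b.
  by rewrite -{1}(opprK b) add -(sub0r b) add l0 sub0r opprK.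
move=> k c d; rewrite lD; congr (_ + _).
have lS I (s : seq I) (F : I -> {freeg K / R}) :
    fglift g (\sum_(i <- s) F i) = \sum_(i <- s) fglift g (F i).
  by elim: s => [|i s IH]; rewrite ?big_nil // !big_cons lD IH.
have -> : fglift g c = \sum_(x <- dom c) coeff x c *: g x.
  rewrite -{1}(freeg_sumE c) lS; apply: eq_bigr => x _; exact: liftU.
have -> : k *: c = \sum_(x <- dom c) << k * coeff x c *g x >> by [].
rewrite lS scaler_sumr; apply: eq_bigr => x _.
by rewrite liftU scalerA.
Qed.

HB.instance Definition _ :=
  GRing.isLinear.Build R {freeg K / R} M *:%R (fglift g) fglift_is_linear.

End Fglift.

Lemma linear_freeg_eq (R : nzRingType) (K : choiceType) (M : lmodType R)
    (a b : {linear {freeg K / R} -> M}) :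
  (forall t, a << t >> = b << t >>) -> a =1 b.
Proof.
move=> ab c; rewrite -(freeg_sumE c) !linear_sum; apply: eq_bigr => t _.
suff -> : << coeff t c *g t >> = coeff t c *: << t >> :> {freeg K / R}.
  by rewrite !linearZ_LR ab.
by apply/eqP/freeg_eqP => x; rewrite coeffZ !coeffU mul1r.
Qed.

(* [submodClosed] does not record closure under opposite, which the additive
   quotient [Quotient.quot] asks for. *)
Record submodule (R : pzRingType) (M : lmodType R) := Submodule {
  submod_pred :> {pred M};
  submod_closedP : submod_closed submod_pred }.

HB.instance Definition _ (R : pzRingType) (M : lmodType R) (N : submodule M) :=
  GRing.isZmodClosed.Build M (submod_pred N)
    (GRing.submod_closedB (submod_closedP N)).

Section QuotientModule.
Variables (R : pzRingType) (M : lmodType R) (N : submodule M).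
Local Open Scope quotient_scope.

Definition quotmod := Quotient.quot (GRing.ZmodClosed.clone M (submod_pred N) _).

HB.instance Definition _ := GRing.Zmodule.on quotmod.
HB.instance Definition _ := ZmodQuotient.on quotmod.

Definition quotmod_scale (a : R) (u : quotmod) : quotmod :=
  \pi_quotmod (a *: repr u).

Lemma quotmod_piP (x y : M) :
  reflect (\pi_quotmod x = \pi_quotmod y) (x - y \in N).
Proof. by apply: (iffP idP); rewrite Quotient.idealrBE => /eqP. Qed.

Lemma pi_quotmod_scale a x :
  quotmod_scale a (\pi_quotmod x) = \pi_quotmod (a *: x).
Proof.
apply/quotmod_piP; rewrite -scalerBr -[_ *: _]addr0.
have [N0 lN] := submod_closedP N; apply: lN N0.
by apply/quotmod_piP; rewrite reprK.
Qed.

Lemma quotmod_scaleA a b u :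
  quotmod_scale a (quotmod_scale b u) = quotmod_scale (a * b) u.
Proof. by elim/quotW: u => u; rewrite (pi_quotmod_scale b) !pi_quotmod_scale scalerA. Qed.

Lemma quotmod_scale1 : left_id 1 quotmod_scale.
Proof. by elim/quotW => u; rewrite pi_quotmod_scale scale1r. Qed.

Lemma quotmod_scaleDr : right_distributive quotmod_scale +%R.
Proof.
move=> a; elim/quotW => u; elim/quotW => v.
by rewrite -raddfD !pi_quotmod_scale -raddfD scalerDr.
Qed.

Lemma quotmod_scaleDl u : {morph quotmod_scale^~ u : a b / a + b}.
Proof.
elim/quotW: u => u a b.
by rewrite !pi_quotmod_scale -raddfD scalerDl.
Qed.

HB.instance Definition _ := GRing.Zmodule_isLmodule.Build R quotmod
  quotmod_scaleA quotmod_scale1 quotmod_scaleDr quotmod_scaleDl.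

Definition quot_class (x : M) : quotmod := \pi_quotmod x.

Definition quot_repr (u : quotmod) : M := repr u.

Lemma quot_reprK : cancel quot_repr quot_class.
Proof. exact: reprK. Qed.

Lemma quot_classP x y : quot_class x = quot_class y <-> x - y \in N.
Proof. by split => /quotmod_piP. Qed.

Lemma quot_class_linear : linear quot_class.
Proof.
move=> a x y; rewrite /quot_class raddfD; congr (_ + _).
exact: esym (pi_quotmod_scale a x).
Qed.

HB.instance Definition _ := GRing.isLinear.Build R M quotmod *:%R quot_class
  quot_class_linear.

End QuotientModule.

Notation simplex X k := {ffun 'I_k.+1 -> vertex X}.
Notation chain R X k := {freeg (simplex X k) / R}.

Section Chains.
Variables (R : realType) (X : graph).

Definition face k (j : 'I_k.+2) (t : simplex X k.+1) : simplex X k :=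
  [ffun i => t (fintype.lift j i)].

Definition boundary k : chain R X k.+1 -> chain R X k :=
  fglift (fun t => \sum_(j < k.+2) (-1) ^+ j *: << face j t >>).

Definition l1norm k (c : chain R X k) : R := \sum_(t <- dom c) `|coeff t c|.

Definition small (r : nat) k (t : simplex X k) :=
  forall i j, (dist (t i) (t j) <= r)%N.

Definition small_chain (r : nat) k : set (chain R X k) :=
  [set c | exists s : seq (R * simplex X k),
     (forall p, p \in s -> small r p.2) /\ c = \sum_(p <- s) p.1 *: << p.2 >>].

HB.instance Definition _ k := GRing.Linear.on (@boundary k).

Lemma boundaryU k (t : simplex X k.+1) :
  boundary << t >> = \sum_(j < k.+2) (-1) ^+ j *: << face j t >>.
Proof. by rewrite /boundary liftU scale1r. Qed.

Lemma boundaryK k (c : chain R X k.+2) : boundary (boundary c) = 0.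
Proof.
pose Z : {linear chain R X k.+2 -> chain R X k} := @GRing.null_fun _ _.
apply: (@linear_freeg_eq _ _ _ (@boundary k \o @boundary k.+1) Z) => t.
rewrite /Z /= boundaryU linear_sum /=.
pose F (p : 'I_k.+3 * 'I_k.+2) : chain R X k :=
  (-1) ^+ (p.1 + p.2) *: << face p.2 (face p.1 t) >>.
transitivity (\sum_p F p).
  rewrite -(pair_bigA _ (fun j i => F (j, i))); apply: eq_bigr => j _.
  rewrite linearZ_LR /= boundaryU scaler_sumr; apply: eq_bigr => i _.
  by rewrite scalerA -exprD.
pose s (p : 'I_k.+3 * 'I_k.+2) : 'I_k.+3 * 'I_k.+2 :=
  if (p.2 < p.1)%N then (inord p.2, inord p.1.-1)
  else (inord p.2.+1, inord p.1).
have sK : involutive s.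
  case=> [[j hj] [i hi]]; rewrite /s /=; case: (ltnP i j) => ij /=.
    have -> : ((inord j.-1 : 'I_k.+2) < (inord i : 'I_k.+3))%N = false.
      by rewrite !inordK //; lia.
    by congr (_, _); apply/val_inj; rewrite /= !inordK //; lia.
  have -> : ((inord j : 'I_k.+2) < (inord i.+1 : 'I_k.+3))%N = true.
    by rewrite !inordK //; lia.
  by congr (_, _); apply/val_inj; rewrite /= !inordK //; lia.
have Fs p : F (s p) = - F p.
  case: p => [[j hj] [i hi]]; rewrite /F /s /= -scaleNr.
  case: (ltnP i j) => ij /=; rewrite !inordK; try lia.
    congr (_ *: << _ >>).
      by rewrite -(prednK (leq_ltn_trans (leq0n i) ij)) /= addSn exprS mulN1r
        opprK addnC.
    apply/ffunP => l; rewrite !ffunE; congr (t _); apply/val_inj.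
    by rewrite /= !inordK /bump; lia.
  congr (_ *: << _ >>); first by rewrite addSn exprS mulN1r addnC.
  apply/ffunP => l; rewrite !ffunE; congr (t _); apply/val_inj.
  by rewrite /= !inordK /bump; lia.
have eS : \sum_p F p = - \sum_p F p.
  rewrite {1}(reindex_inj (inv_inj sK)) -sumrN.
  by apply: eq_bigr => p _; exact: Fs.
have /eqP : 2%:R *: (\sum_p F p) = 0.
  by rewrite scaler_nat mulr2n {1}eS addNr.
by rewrite scaler_eq0 pnatr_eq0 => /eqP.
Qed.

Lemma coeff_small_chain r k (c : chain R X k) t :
  small_chain r c -> coeff t c != 0 -> small r t.
Proof.
case=> s [sm ->]; apply: contra_neqP => nt.
rewrite raddf_sum /= big_seq big1 // => p ps.
rewrite coeffZ coeffU; case: eqP => [e|_]; last by rewrite !mulr0.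
by exfalso; apply: nt; rewrite -e; apply: sm.
Qed.

End Chains.

Section Cochains.
Variables (R : realType) (X : graph) (YY : set (subgraph X)).
Variable V : normedModType R.

Definition bounded_on k (C : set (chain R X k)) (a : chain R X k -> V) :=
  exists M, forall c, C c -> `|a c| <= M * l1norm c.

(* The degree-k cochains, as a subspace of the space of all functions. *)
Definition relcochain k : {pred chain R X k -> V} := fun a =>
  `[< [/\ linear a,
          forall r, bounded_on (@small_chain R X r k) a
        & forall Y (t : simplex X k),
            YY Y -> (forall i, verts Y (t i)) -> a << t >> = 0] >].

Definition coboundary k (a : chain R X k -> V) : chain R X k.+1 -> V :=
  a \o @boundary R X k.

Lemma bounded_on_smallP r k (a : chain R X k -> V) : linear a ->
  bounded_on (@small_chain R X r k) a <->
  exists M, forall t, small r t -> `|a << t >>| <= M.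
Proof.
move=> la; pose A : {linear _ -> V} := HB.pack a (GRing.isLinear.Build _ _ _ _ _ la).
split=> -[M hM]; exists M; [move=> t st|move=> c sc].
  have /hM : small_chain r (<< t >> : chain R X k).
    exists [:: (1, t)]; rewrite big_seq1 scale1r; split=> // p.
    by rewrite inE => /eqP ->.
  by rewrite /l1norm domU1 big_seq1 coeffU eqxx mulr1 normr1 mulr1.
have -> : a c = \sum_(t <- dom c) coeff t c *: a << t >>.
  rewrite -[in LHS](freeg_sumE c) -[a]/(A : _ -> _) linear_sum.
  apply: eq_bigr => t _; rewrite -linearZ_LR; congr (A _).
  by apply/eqP/freeg_eqP => x; rewrite coeffZ !coeffU mul1r.
apply: le_trans (ler_norm_sum _ _ _) _; rewrite /l1norm mulr_sumr.
rewrite big_seq [leRHS]big_seq; apply: ler_sum => t; rewrite mem_dom => ct.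
rewrite normrZ mulrC ler_wpM2r //; apply: hM.
exact: coeff_small_chain sc ct.
Qed.

Lemma relcochain_closed k : submod_closed (@relcochain k).
Proof.
split.
  apply/asboolP; split=> [x c d||//]; first by rewrite scaler0 addr0.
  by move=> r; exists 0 => c _; rewrite mul0r normr0.
move=> x a b /asboolP[la ba va] /asboolP[lb bb vb].
apply/asboolP; split=> [y c d|r|Y t YYt tY].
- rewrite !fctE la lb !scalerDr !scalerA (mulrC x y).
  by rewrite addrACA.
- have [M hM] := ba r; have [N hN] := bb r.
  exists (`|x| * M + N) => c sc; rewrite !fctE.
  apply: le_trans (ler_normD _ _) _; rewrite normrZ mulrDl -mulrA.
  by apply: lerD; [apply: ler_wpM2l => //; apply: hM|apply: hN].
- by rewrite !fctE (va Y) // (vb Y) // scaler0 addr0.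
Qed.

Lemma coboundary_linear k : linear (@coboundary k).
Proof. by move=> x a b; apply/funext. Qed.

HB.instance Definition _ k := GRing.isLinear.Build R _ _ _ (@coboundary k)
  (@coboundary_linear k).

Lemma coboundary_relcochain k (a : chain R X k -> V) :
  a \in @relcochain k -> coboundary a \in @relcochain k.+1.
Proof.
move=> /asboolP[la ba va].
pose A : {linear _ -> V} := HB.pack a (GRing.isLinear.Build _ _ _ _ _ la).
have cE t : coboundary a << t >> = \sum_(j < k.+2) (-1) ^+ j *: a << face j t >>.
  rewrite /coboundary /= boundaryU -[a]/(A : _ -> _) linear_sum.
  by apply: eq_bigr => j _; rewrite linearZ_LR.
have lc : linear (coboundary a) by move=> x c d; rewrite /coboundary /= linearP la.
apply/asboolP; split=> // [r|Y t YYt tY].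
  apply/bounded_on_smallP => //; have /bounded_on_smallP [//|M hM] := ba r.
  exists (\sum_(j < k.+2) M) => t st; rewrite cE.
  apply: le_trans (ler_norm_sum _ _ _) _; apply: ler_sum => j _.
  rewrite normrZ normrX normrN1 expr1n mul1r; apply: hM => i i'.
  by rewrite !ffunE.
rewrite cE big1 // => j _; rewrite (va Y) ?scaler0 // => i.
by rewrite ffunE.
Qed.

Lemma coboundaryK k (a : chain R X k -> V) :
  linear a -> coboundary (coboundary a) = 0.
Proof.
move=> la.
pose A : {linear _ -> V} := HB.pack a (GRing.isLinear.Build _ _ _ _ _ la).
by apply/funext => c; rewrite /coboundary /= boundaryK -[a]/(A : _ -> _) linear0.
Qed.

Definition cocycle_pred k : {pred chain R X k -> V} :=
  fun a => `[< a \in @relcochain k /\ coboundary a = 0 >].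

Lemma cocycle_closed k : submod_closed (@cocycle_pred k).
Proof.
have [c0 lc] := relcochain_closed k; split.
  by apply/asboolP; split=> //; rewrite raddf0.
move=> x a b /asboolP[ca za] /asboolP[cb zb].
by apply/asboolP; split; [exact: lc|rewrite coboundary_linear za zb scaler0 addr0].
Qed.

HB.instance Definition _ k := GRing.isSubmodClosed.Build R _ (@cocycle_pred k)
  (GRing.submod_closed_semi (cocycle_closed k)).

Record cocycle k := Cocycle {
  cocycle_fun :> chain R X k -> V;
  cocycleP : cocycle_fun \in @cocycle_pred k }.

HB.instance Definition _ k :=
  [isSub of cocycle k for @cocycle_fun k].
HB.instance Definition _ k := [Choice of cocycle k by <:].
HB.instance Definition _ k := [SubChoice_isSubLmodule of cocycle k by <:].

Lemma cocycle_fun_linear k : linear (@cocycle_fun k).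
Proof. exact: (linearP (val : cocycle k -> _)). Qed.

Definition is_coboundary k : (chain R X k -> V) -> Prop :=
  match k with
  | 0%N => fun a => a = 0
  | m.+1 => fun a => exists2 b, b \in @relcochain m & a = coboundary b
  end.

Definition coboundary_pred k : {pred cocycle k} :=
  fun z => `[< is_coboundary (z : chain R X k -> V) >].

Lemma coboundary_closed k : submod_closed (@coboundary_pred k).
Proof.
case: k => [|k]; split.
- exact/asboolP.
- move=> x a b /asboolP/= az /asboolP/= bz; apply/asboolP.
  by rewrite cocycle_fun_linear /= az bz scaler0 addr0.
- apply/asboolP; exists 0; first by have [] := relcochain_closed k.
  by rewrite raddf0.
- move=> x a b /asboolP[a' ca ea] /asboolP[b' cb eb]; apply/asboolP.
  exists (x *: a' + b'); first by have [_] := relcochain_closed k; exact.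
  by rewrite cocycle_fun_linear ea eb coboundary_linear.
Qed.

Definition coboundaries k : submodule (cocycle k) :=
  Submodule (@coboundary_closed k).

Definition cohomology k := quotmod (coboundaries k).

HB.instance Definition _ k := GRing.Lmodule.on (cohomology k).

Definition cohomology_class k : cocycle k -> cohomology k :=
  @quot_class _ _ (coboundaries k).

End Cochains.

(* [fs] is a map from YY to YY'; its values outside YY are irrelevant. *)
Definition rel_coarsely_uniform (R : realType) (X X' : graph)
    (YY : set (subgraph X)) (YY' : set (subgraph X'))
    (f : X -> X') (fs : subgraph X -> subgraph X') :=
  [/\ set_fun YY YY' fs,
      forall Y, YY Y -> f @` verts Y `<=` verts (fs Y)
    & exists2 rho_p : R -> R, control rho_p &
        forall x1 x2, common YY x1 x2 \/
          (dist (f x1) (f x2))%:R <= rho_p (dist x1 x2)%:R].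

Section Pullback.
Variables (R : realType) (X X' : graph).
Variables (YY : set (subgraph X)) (YY' : set (subgraph X')).
Variables (V : normedModType R) (f : X -> X').

Definition push_simplex k (t : simplex X k) : simplex X' k :=
  [ffun i => f (t i)].

Definition push k : chain R X k -> chain R X' k :=
  fglift (fun t => << push_simplex t >>).

HB.instance Definition _ k := GRing.Linear.on (@push k).

Lemma pushU k (t : simplex X k) : push << t >> = << push_simplex t >>.
Proof. by rewrite /push liftU scale1r. Qed.

Lemma push_boundary k (c : chain R X k.+1) :
  push (boundary c) = boundary (push c).
Proof.
apply: (@linear_freeg_eq _ _ _ (@push k \o @boundary R X k)
  (@boundary R X' k \o @push k.+1)) => t.
rewrite /= pushU !boundaryU linear_sum; apply: eq_bigr => j _.
rewrite linearZ_LR /= pushU; congr (_ *: << _ >>).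
by apply/ffunP => i; rewrite !ffunE.
Qed.

(* On basis elements: pull a << t >> = a << f \o t >>. Well-definedness of the
   pull-back on bounded cochains ([pull_relcochain]) needs YY to be disjoint
   and X' to be connected. *)
Definition pull k (a : chain R X' k -> V) : chain R X k -> V := a \o @push k.

Lemma pull_linear k : linear (@pull k).
Proof. by move=> x a b; apply/funext. Qed.

Lemma pull_coboundary k (a : chain R X' k -> V) :
  pull (coboundary a) = coboundary (pull a).
Proof.
by apply/funext => c; rewrite /pull /coboundary /= push_boundary.
Qed.

Variable fs : subgraph X -> subgraph X'.
Hypothesis connX' : connected_graph X'.
Hypothesis disjYY : trivIset YY (@verts X).
Hypothesis hf : rel_coarsely_uniform R YY YY' f fs.

Lemma pull_relcochain k (a : chain R X' k -> V) :
  a \in @relcochain R X' YY' V k -> pull a \in @relcochain R X YY V k.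
Proof.
case: hf => fsP fY [rho [rho0 rhoM] frho] /asboolP[la ba va].
have lc : linear (pull a) by move=> x c d; rewrite /pull /= linearP la.
have va' (Y : subgraph X) (t : simplex X k) :
    YY Y -> (forall i, verts Y (t i)) -> pull a << t >> = 0.
  move=> YYY tY; rewrite /pull /= pushU; apply: (va (fs Y)); first exact: fsP.
  by move=> i; rewrite ffunE; apply: (fY Y) => //; exists (t i).
apply/asboolP; split=> // r; apply/bounded_on_smallP => //.
pose D := rho r%:R + rho r%:R.
have D0 : 0 <= D by rewrite addr_ge0 // rho0.
have [M hM] := (bounded_on_smallP (Num.truncn D) la).1 (ba _).
exists (Num.max M 0) => t st.
have [[Y YYY tY]|nY] := pselect (exists2 Y, YY Y & forall i, verts Y (t i)).
  by rewrite (va' Y) // normr0 le_max lexx orbT.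
have dr i j : ~ common YY (t i) (t j) ->
    (dist (f (t i)) (f (t j)))%:R <= rho r%:R.
  move=> nc; case: (frho (t i) (t j)) => // /le_trans; apply.
  by apply: rhoM; rewrite ?ler_nat.
rewrite le_max /pull /= pushU hM // => i j; rewrite !ffunE.
rewrite -ltnS -(ltr_nat R); apply: le_lt_trans (truncnS_gt _).
have [[Y YYY [Yi Yj]]|nc] := pselect (common YY (t i) (t j)); last first.
  by apply: le_trans (dr _ _ nc) _; rewrite lerDl rho0.
have [l nYl] : exists l, ~ verts Y (t l).
  by apply: contra_notP nY => /forallNP h; exists Y => // l; apply: contrapT.
have nl m : verts Y (t m) -> ~ common YY (t m) (t l).
  move=> Ym [Y2 YY2 [Y2m Y2l]]; apply: nYl.
  by rewrite (disjYY YYY YY2) //; exists (t m).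
apply: le_trans (_ : (dist (f (t i)) (f (t l)) + dist (f (t l)) (f (t j)))%:R <= _).
  by rewrite ler_nat dist_triangle.
rewrite natrD lerD //; first exact/dr/nl.
by rewrite dist_sym //; exact/dr/nl.
Qed.

Lemma pull_cocycle_subproof k (z : cocycle YY' V k) :
  pull z \in @cocycle_pred R X YY V k.
Proof.
case: z => a /= /asboolP[ca za]; apply/asboolP; split.
  exact: pull_relcochain.
by rewrite -pull_coboundary za.
Qed.

Definition pull_cocycle k (z : cocycle YY' V k) : cocycle YY V k :=
  Cocycle (pull_cocycle_subproof z).

Lemma pull_cocycle_linear k : linear (@pull_cocycle k).
Proof.
move=> x a b; apply/val_inj; rewrite [RHS]cocycle_fun_linear -pull_linear.
by rewrite -cocycle_fun_linear.
Qed.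

HB.instance Definition _ k := GRing.isLinear.Build R _ _ _ (@pull_cocycle k)
  (@pull_cocycle_linear k).

Lemma pull_is_coboundary k (z : cocycle YY' V k) :
  z \in @coboundary_pred R X' YY' V k ->
  pull_cocycle z \in @coboundary_pred R X YY V k.
Proof.
case: k z => [|k] z.
  by move=> /asboolP/= z0; apply/asboolP; rewrite /= z0.
move=> /asboolP[b cb eb]; apply/asboolP; exists (pull b).
  exact: pull_relcochain.
by rewrite /= eb pull_coboundary.
Qed.

Definition pullback_fun k (h : cohomology YY' V k) : cohomology YY V k :=
  cohomology_class (pull_cocycle (quot_repr h)).

Lemma pullback_class k (z : cocycle YY' V k) :
  pullback_fun (cohomology_class z) = cohomology_class (pull_cocycle z).
Proof.
apply/quot_classP; rewrite -linearB; apply: pull_is_coboundary.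
exact/(@quot_classP _ _ (coboundaries YY' V k))/quot_reprK.
Qed.

Lemma pullback_linear k : linear (@pullback_fun k).
Proof.
move=> x u v; rewrite -(quot_reprK u) -(quot_reprK v).
rewrite -quot_class_linear [LHS]pullback_class pull_cocycle_linear.
rewrite [LHS]quot_class_linear.
by congr (_ *: _ + _); exact/esym/pullback_class.
Qed.

HB.instance Definition _ k := GRing.isLinear.Build R _ _ _ (@pullback_fun k)
  (@pullback_linear k).

Definition pullback k : {linear cohomology YY' V k -> cohomology YY V k} :=
  @pullback_fun k.

End Pullback.

(* Main.v *)
(* A coarse inverse g : X' -> X sends x' in Y' = f_#(Y) to a y in Y such that
   d(x', f(y)) is controlled by the distance from x' to X' \ Y' (condition
   (d) at a point of X' \ Y' nearest to x'), and any other x' to a preimage.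
   Then f g and g f are only relatively close to the identity: d(x1, f g x2)
   is controlled by d(x1, x2) when x1, x2 lie in no common Y', and may be
   unbounded otherwise. This is enough for the prism operator to preserve
   bounded relative cochains: a small simplex contained in some Y contributes
   0, and in any other one two vertices of the same Y are compared through a
   vertex outside Y. If some Y' is all of X', no such g need exist, but then
   both cochain complexes are 0. *)
From HB Require Import structures.
Require Import Defs.
From mathcomp Require Import freeg zify.
From mathcomp Require Import all_boot all_order all_algebra.
From mathcomp Require Import boolp classical_sets functions reals topology.
From mathcomp Require Import normedtype.

Import Order.TTheory GRing.Theory Num.Theory.
Import numFieldNormedType.Exports.

Local Open Scope classical_set_scope.
Local Open Scope ring_scope.

(* Tuples of length [n] rather than of dimension [n]: a chain of degree k is an
   [achain] of length k.+1, and length 0 gives the augmentation, which spares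
   the special case of degree 0 in the homotopy formula. *)
Notation achain R X n := {freeg {ffun 'I_n -> vertex X} / R}.

(** * Augmented chains and the cone operator *)

Section AugmentedChains.
Context {R : realType} {X : graph}.

Definition tcons {n} (x : X) (t : {ffun 'I_n -> X}) : {ffun 'I_n.+1 -> X} :=
  [ffun i => if unlift ord0 i is Some j then t j else x].

Definition tbehead {n} (t : {ffun 'I_n.+1 -> X}) : {ffun 'I_n -> X} :=
  [ffun i => t (lift ord0 i)].

Lemma tcons0 n x (t : {ffun 'I_n -> X}) : tcons x t ord0 = x.
Proof. by rewrite ffunE unlift_none. Qed.

Lemma tconsS n x (t : {ffun 'I_n -> X}) i : tcons x t (lift ord0 i) = t i.
Proof. by rewrite ffunE liftK. Qed.

Lemma tcons_behead n (t : {ffun 'I_n.+1 -> X}) : tcons (t ord0) (tbehead t) = t.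
Proof.
by apply/ffunP => i; case: (unliftP ord0 i) => [j|] ->; rewrite ?tconsS ?tcons0 ?ffunE.
Qed.

Definition tface {n} (j : 'I_n.+1) (t : {ffun 'I_n.+1 -> X}) : {ffun 'I_n -> X} :=
  [ffun i => t (lift j i)].

Lemma tface_cons0 n x (t : {ffun 'I_n -> X}) : tface ord0 (tcons x t) = t.
Proof. by apply/ffunP => i; rewrite ffunE tconsS. Qed.

Lemma tface_consS n x (t : {ffun 'I_n.+1 -> X}) (j : 'I_n.+1) :
  tface (lift ord0 j) (tcons x t) = tcons x (tface j t).
Proof.
apply/ffunP => i; rewrite ffunE; case: (unliftP ord0 i) => [i'|] ->; last first.
  suff -> : lift (lift ord0 j) ord0 = ord0 by rewrite !tcons0.
  exact/val_inj.
suff -> : lift (lift ord0 j) (lift ord0 i') = lift ord0 (lift j i').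
  by rewrite !tconsS ffunE.
by apply/val_inj; rewrite /= /bump /=; lia.
Qed.

Definition aboundary {n} : achain R X n.+1 -> achain R X n :=
  fglift (fun t => \sum_(j < n.+1) (-1) ^+ j *: << tface j t >>).
HB.instance Definition _ n := GRing.Linear.on (@aboundary n).

Lemma aboundaryU n (t : {ffun 'I_n.+1 -> X}) :
  aboundary << t >> = \sum_(j < n.+1) (-1) ^+ j *: << tface j t >>.
Proof. by rewrite /aboundary liftU scale1r. Qed.

Definition cone {n} (x : X) : achain R X n -> achain R X n.+1 :=
  fglift (fun t => << tcons x t >>).
HB.instance Definition _ n x := GRing.Linear.on (@cone n x).

Lemma coneU n x (t : {ffun 'I_n -> X}) : cone x << t >> = << tcons x t >>.
Proof. by rewrite /cone liftU scale1r. Qed.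

(** Face 0 of a cone is its base; every other face is the cone over a face of the base, with the
    sign shifted by one. *)
Lemma aboundary_cone n x (c : achain R X n.+1) :
  aboundary (cone x c) = c - cone x (aboundary c).
Proof.
apply: (@linear_freeg_eq _ _ _ (@aboundary n.+1 \o @cone n.+1 x)
  (idfun \- (@cone n x \o @aboundary n))) => t /=.
rewrite coneU !aboundaryU big_ord_recl expr0 scale1r tface_cons0; congr (_ + _).
rewrite linear_sum -sumrN; apply: eq_bigr => j _.
rewrite lift0 tface_consS exprS mulN1r scaleNr; congr (- _).
by rewrite linearZ_LR /= coneU.
Qed.

Lemma aboundary_cone0 x (c : achain R X 0) : aboundary (cone x c) = c.
Proof.
apply: (@linear_freeg_eq _ _ _ (@aboundary 0 \o @cone 0 x) idfun) => t /=.
by rewrite coneU aboundaryU big_ord_recl big_ord0 addr0 expr0 scale1r tface_cons0.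
Qed.

End AugmentedChains.

Lemma sub_subKA (V : zmodType) (a b c d : V) :
  a - d - (a - b - c) = b - (d - c).
Proof.
by rewrite -[a - b - c]addrA -opprD opprB [LHS]addrC [LHS]addrA opprB subrK addrA.
Qed.

Lemma sub_subACA (V : zmodType) (a b c d : V) :
  a - b - (c - d) = a - c - (b - d).
Proof. by rewrite !opprB addrACA [RHS]addrACA [- b - c]addrC. Qed.

(** * The prism operator and its homotopy formula *)

Section Prism.
Context {R : realType} {X X' : graph}.
Implicit Types f : X -> X'.

Definition tmap {n} f (t : {ffun 'I_n -> X}) : {ffun 'I_n -> X'} :=
  [ffun i => f (t i)].

Definition amap {n} f : achain R X n -> achain R X' n :=
  fglift (fun t => << tmap f t >>).
HB.instance Definition _ n f := GRing.Linear.on (@amap n f).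

Lemma amapU n f (t : {ffun 'I_n -> X}) : amap f << t >> = << tmap f t >>.
Proof. by rewrite /amap liftU scale1r. Qed.

Lemma tmap_cons n f x (t : {ffun 'I_n -> X}) :
  tmap f (tcons x t) = tcons (f x) (tmap f t).
Proof.
apply/ffunP => i; rewrite ffunE.
by case: (unliftP ord0 i) => [j|] ->; rewrite ?tconsS ?tcons0 ?ffunE.
Qed.

Lemma amap_cone n f x (c : achain R X n) :
  amap f (cone x c) = cone (f x) (amap f c).
Proof.
apply: (@linear_freeg_eq _ _ _ (amap f \o cone x) (cone (f x) \o amap f)) => t /=.
by rewrite coneU !amapU coneU tmap_cons.
Qed.

Lemma amap_aboundary n f (c : achain R X n.+1) :
  amap f (aboundary c) = aboundary (amap f c).
Proof.
apply: (@linear_freeg_eq _ _ _ (amap f \o aboundary) (aboundary \o amap f)) => t /=.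
rewrite amapU !aboundaryU linear_sum; apply: eq_bigr => j _.
rewrite linearZ_LR /= amapU; congr (_ *: << _ >>).
by apply/ffunP => i; rewrite !ffunE.
Qed.

(** Indexing the two maps by a boolean gives every vertex of a prism the uniform shape
    [h b (t i)]. *)
Variable h : bool -> X -> X'.

(* The prism operator
     (x_0, .., x_k) |-> sum_i (-1)^i (h0 x_0, .., h0 x_i, h1 x_i, .., h1 x_k),
   written recursively on the length of the tuple. *)
Fixpoint tprism n : {ffun 'I_n -> X} -> achain R X' n.+1 :=
  match n with
  | 0%N => fun _ => 0
  | m.+1 => fun t => cone (h false (t ord0))
      (<< tmap (h true) t >> - tprism m (tbehead t))
  end.

Definition prism {n} : achain R X n -> achain R X' n.+1 := fglift (tprism n).
HB.instance Definition _ n := GRing.Linear.on (@prism n).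

Lemma prism0 (c : achain R X 0) : prism c = 0.
Proof.
pose Z : {linear achain R X 0 -> achain R X' 1} := @GRing.null_fun _ _.
apply: (@linear_freeg_eq _ _ _ prism Z) => t /=.
by rewrite /prism liftU scaler0.
Qed.

Lemma prismU n (t : {ffun 'I_n.+1 -> X}) :
  prism << t >> =
  cone (h false (t ord0)) (<< tmap (h true) t >> - prism << tbehead t >>).
Proof. by rewrite /prism !liftU !scale1r. Qed.

Lemma prism_cone n x (c : achain R X n) :
  prism (cone x c) = cone (h false x) (amap (h true) (cone x c) - prism c).
Proof.
apply: (@linear_freeg_eq _ _ _ (prism \o cone x)
  (cone (h false x) \o ((amap (h true) \o cone x) \- prism))) => t /=.
rewrite coneU prismU tcons0 amapU; congr (cone _ (_ - prism << _ >>)).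
by apply/ffunP => i; rewrite ffunE tconsS.
Qed.

(** Induction on the length: a tuple is the cone from its first vertex over the rest, [prism_cone]
    and [aboundary_cone] move the boundary past that cone, and the induction hypothesis handles the
    rest. *)
Lemma prism_homotopy n (c : achain R X n.+1) :
  aboundary (prism c) = amap (h true) c - amap (h false) c - prism (aboundary c).
Proof.
elim: n => [|n IH] in c *.
- apply: (@linear_freeg_eq _ _ _ (aboundary \o prism)
    (amap (h true) \- amap (h false) \- (prism \o aboundary))) => t /=.
  rewrite prism0 subr0 -(tcons_behead _ t) -coneU prism_cone prism0 subr0.
  rewrite aboundary_cone !amap_cone; congr (_ - cone _ _).
  rewrite aboundary_cone0 !amapU; congr (<< _ >>).
  by apply/ffunP => -[].
apply: (@linear_freeg_eq _ _ _ (aboundary \o prism)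
  (amap (h true) \- amap (h false) \- (prism \o aboundary))) => t /=.
rewrite -(tcons_behead _ t) -coneU; move: (t ord0) (tbehead t) => x {}t.
move: (<< t >> : achain R X n.+1) => {}c.
have e : aboundary (amap (h true) (cone x c) - prism c) =
    amap (h false) c - (amap (h true) (cone x (aboundary c)) - prism (aboundary c)).
  rewrite linearB /= IH -amap_aboundary aboundary_cone linearB /=.
  exact: sub_subKA.
rewrite prism_cone aboundary_cone e aboundary_cone.
rewrite [prism (_ - _)]linearB /= prism_cone (amap_cone _ (h false)).
by rewrite [cone _ (amap (h false) c - _)]linearB /=; exact: sub_subACA.
Qed.

(** The prism over a tuple of length [n] is a signed sum of [n] tuples with vertices of the form
    [h b (t i)]. *)
Lemma prism_bound (V : normedModType R) n (t : {ffun 'I_n -> X})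
    (a : {linear achain R X' n.+1 -> V}) M :
  (forall s : {ffun 'I_n.+1 -> X'},
    (forall j, exists b i, s j = h b (t i)) -> `|a << s >>| <= M) ->
  `|a (prism << t >>)| <= M *+ n.
Proof.
elim: n => [|n IH] in t a *; first by rewrite prism0 linear0 normr0.
move=> aM; rewrite prismU linearB /= linearB /= mulrS.
apply: le_trans (ler_normB _ _) _; apply: lerD.
  rewrite coneU; apply: aM => j; case: (unliftP ord0 j) => [i|] ->.
    by exists true, i; rewrite tconsS ffunE.
  by exists false, ord0; rewrite tcons0.
(* The cone is absorbed into the functional, to which the induction hypothesis then applies. *)
apply: (IH (tbehead t) (a \o cone (h false (t ord0)))) => s sP /=.
rewrite coneU; apply: aM => j; case: (unliftP ord0 j) => [i|] ->.
  by have [b [i' e]] := sP i; exists b, (lift ord0 i'); rewrite tconsS e ffunE.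
by exists false, ord0; rewrite tcons0.
Qed.

End Prism.

(** * Homotopy invariance for relatively close maps *)

Section Homotopy.
Context {R : realType} {X X' : graph}.
Context {YY : set (subgraph X)} {YY' : set (subgraph X')}.
Context (V : normedModType R) (connX' : connected_graph X').
Context (disjYY : trivIset YY (@verts X)).
Context (h : bool -> X -> X') (fs : subgraph X -> subgraph X').
Hypothesis fsP : set_fun YY YY' fs.
Hypothesis hY : forall b Y x, YY Y -> verts Y x -> verts (fs Y) (h b x).
(** For [b = c] this is relative coarse uniformity of [h b]; for distinct [b] and [c] it is relative
    closeness of the two maps. *)
Hypothesis hD : forall r, exists D, forall b c x1 x2, ~ common YY x1 x2 ->
  (dist x1 x2 <= r)%N -> (dist (h b x1) (h c x2) <= D)%N.

Lemma comp_prism_relcochain k (a : chain R X' k.+1 -> V) :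
  a \in @relcochain R X' YY' V k.+1 ->
  a \o @prism R X X' h k.+1 \in @relcochain R X YY V k.
Proof.
move=> /asboolP[la ba va].
pose A : {linear _ -> V} := HB.pack a (GRing.isLinear.Build _ _ _ _ _ la).
have lc : linear (a \o @prism R X X' h k.+1) by move=> x c d /=; rewrite linearP la.
have van Y (t : simplex X k) : YY Y -> (forall i, verts Y (t i)) ->
    (a \o @prism R X X' h k.+1) << t >> = 0.
  (* Vanishing is the case of bound 0 in [prism_bound]. *)
  move=> YYY tY; apply/eqP; rewrite -normr_le0 -(mul0rn _ k.+1).
  apply: (@prism_bound _ _ _ h V _ t A) => s sP.
  suff -> : A << s >> = 0 by rewrite normr0.
  apply: (va (fs Y)); first exact: fsP.
  by move=> j; have [b [i ->]] := sP j; exact: hY.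
apply/asboolP; split=> // r; apply/bounded_on_smallP => //.
have [D hD'] := hD r.
(* Two vertices in a common [Y] are joined through a third one, whence [D + D]. *)
have [M hM] := (bounded_on_smallP (D + D) la).1 (ba _).
exists (Num.max M 0 *+ k.+1) => t st.
have [[Y YYY tY]|nY] := pselect (exists2 Y, YY Y & forall i, verts Y (t i)).
  by rewrite (van Y) // normr0 mulrn_wge0 // le_max lexx orbT.
apply: (@prism_bound _ _ _ h V _ t A) => s sP; rewrite le_max hM // => j j'.
have [b [i ->]] := sP j; have [c [i' ->]] := sP j'.
have [[Y YYY [Yi Yi']]|nc] := pselect (common YY (t i) (t i')); last first.
  by apply: leq_trans (hD' _ _ _ _ nc (st _ _)) (leq_addr _ _).
(* By disjointness, [t l] shares no member of [YY] with a vertex in [Y], so both legs of the detour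
   are bounded by [D]. *)
have [l nYl] : exists l, ~ verts Y (t l).
  by apply: contra_notP nY => /forallNP H; exists Y => // l; apply: contrapT.
have nl m : verts Y (t m) -> ~ common YY (t m) (t l).
  move=> Ym [Y2 YY2 [Y2m Y2l]]; apply: nYl.
  by rewrite (disjYY _ _ YYY YY2) //; exists (t m).
apply: leq_trans (dist_triangle _ (h b (t l)) _ connX') _; apply: leq_add.
  exact/hD'/st/nl.
by rewrite dist_sym //; exact/hD'/st/nl.
Qed.

(** In the homotopy formula the cocycle [z] kills the boundary term, leaving [z] of the prism over
    the boundary, that is, the coboundary of [z] composed with the prism. In degree 0 this is a
    prism over empty tuples, hence 0. *)
Lemma homotopic_pulls k (z : chain R X' k -> V) : z \in @cocycle_pred R X' YY' V k ->
  is_coboundary YY (pull (h true) z - pull (h false) z).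
Proof.
move=> /asboolP[cz dz]; have /asboolP[lz _ _] := cz.
pose A : {linear _ -> V} := HB.pack z (GRing.isLinear.Build _ _ _ _ _ lz).
have zB c d : z (c - d) = z c - z d by exact: (linearB A).
have z0 : z 0 = 0 by exact: (linear0 A).
have zd c : z (boundary c) = 0 by have := congr1 (@^~ c) dz.
have E c : pull (h true) z c - pull (h false) z c = z (prism h (@aboundary R X k c)).
  apply/eqP; rewrite -subr_eq0 -!zB -(@prism_homotopy R X X' h); apply/eqP.
  exact: zd.
case: k z cz dz lz A zB z0 zd E => [|k] z cz dz lz A zB z0 zd E /=.
  apply/funext => c; rewrite !fctE E prism0; exact: z0.
exists (z \o @prism R X X' h k.+1); first exact: comp_prism_relcochain.
by apply/funext => c; rewrite !fctE E.
Qed.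

End Homotopy.

(** * Pull-backs along coarse inverses *)

Section PullbackInverse.
Context {R : realType} {X X' : graph}.

Lemma push_id k (c : chain R X k) : push id c = c.
Proof.
apply: (@linear_freeg_eq _ _ _ (@push R X X id k) idfun) => t.
by rewrite /= pushU; congr (<< _ >>); apply/ffunP => i; rewrite ffunE.
Qed.

Lemma push_comp (X2 : graph) (g : X' -> X2) (f : X -> X') k (c : chain R X k) :
  push g (push f c) = push (g \o f) c.
Proof.
apply: (@linear_freeg_eq _ _ _ (@push R X' X2 g k \o @push R X X' f k)
  (@push R X X2 (g \o f) k)) => t.
by rewrite /= !pushU; congr (<< _ >>); apply/ffunP => i; rewrite !ffunE.
Qed.

(** Packs [f] and the identity as the boolean family that the prism expects. *)
Definition toggle (f : X -> X) (b : bool) : X -> X := if b then f else id.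

(** By [homotopic_pulls] for [g \o f] and the identity, pulling back along [g] and then [f] changes
    a cocycle only by a coboundary. *)
Lemma pullbackK {V : normedModType R}
    (connX : connected_graph X) (connX' : connected_graph X')
    (YY : set (subgraph X)) (YY' : set (subgraph X'))
    (disjYY : trivIset YY (@verts X)) (disjYY' : trivIset YY' (@verts X'))
    (f : X -> X') (fs : subgraph X -> subgraph X')
    (hf : rel_coarsely_uniform R YY YY' f fs)
    (g : X' -> X) (gs : subgraph X' -> subgraph X)
    (hg : rel_coarsely_uniform R YY' YY g gs)
    (hY : forall Y x, YY Y -> verts Y x -> verts Y (g (f x)))
    (hD : forall r, exists D, forall b c x1 x2, ~ common YY x1 x2 ->
      (dist x1 x2 <= r)%N ->
      (dist (toggle (g \o f) b x1) (toggle (g \o f) c x2) <= D)%N) k :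
  cancel (pullback V connX disjYY' hg k) (pullback V connX' disjYY hf k).
Proof.
move=> u; rewrite -(quot_reprK u); move: (quot_repr u) => z.
rewrite [pullback _ _ _ hg _ _]pullback_class [LHS]pullback_class.
apply/quot_classP/asboolP.
have -> : cocycle_fun (pull_cocycle connX' disjYY hf
    (pull_cocycle connX disjYY' hg z) - z) =
    pull (toggle (g \o f) true) z - pull (toggle (g \o f) false) z.
  apply: etrans (linearB (val : cocycle YY V k -> _) _ _) _; congr (_ - _).
    by apply/funext => c; congr (z _); exact: push_comp.
  by apply/funext => c; congr (z _); exact/esym/push_id.
apply: (homotopic_pulls (YY' := YY) V connX disjYY (toggle (g \o f)) id) => //.
- by move=> [] // Y x; exact: hY.
- exact: cocycleP.
Qed.

(** For the degenerate case: every simplex lies in [Y], so relative cochains vanish on the basis. *)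
Lemma cohomology_full (V : normedModType R) (YY : set (subgraph X)) Y k :
  YY Y -> (forall x, verts Y x) -> forall u v : cohomology YY V k, u = v.
Proof.
move=> YYY Yx u v; rewrite -(quot_reprK u) -(quot_reprK v).
congr (quot_class _ _); apply/val_inj => /=.
have Z (z : cocycle YY V k) : cocycle_fun z = 0.
  have /asboolP[/asboolP[lz _ vz] _] := cocycleP z.
  pose A : {linear _ -> V} := HB.pack (cocycle_fun z)
    (GRing.isLinear.Build _ _ _ _ _ lz).
  apply/funext; pose Z : {linear chain R X k -> V} := @GRing.null_fun _ _.
  by apply: (@linear_freeg_eq _ _ _ A Z) => t; exact: (vz Y).
by rewrite !Z.
Qed.

Lemma rel_coarsely_uniform_nat (YY : set (subgraph X)) (YY' : set (subgraph X'))
    (f : X -> X') (fs : subgraph X -> subgraph X') :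
  set_fun YY YY' fs -> (forall Y, YY Y -> f @` verts Y `<=` verts (fs Y)) ->
  (forall r, exists D, forall x1 x2, ~ common YY x1 x2 ->
    (dist x1 x2 <= r)%N -> (dist (f x1) (f x2) <= D)%N) ->
  rel_coarsely_uniform R YY YY' f fs.
Proof.
move=> fsP fY /choice[D hD]; split=> //.
(* The chosen bounds [D] need not be monotone in the radius; their running maximum is. *)
exists (fun r => (\max_(i < (Num.truncn r).+1) D i)%:R).
  split=> [r _|r s r0 rs]; first exact: ler0n.
  rewrite ler_nat; apply/bigmax_leqP => i _.
  have ltis : (i < (Num.truncn s).+1)%N.
    by rewrite (leq_trans (ltn_ord i)) // ltnS le_truncn.
  exact: (leq_bigmax (Ordinal ltis)).
move=> x1 x2; have [|nc] := pselect (common YY x1 x2); [by left|right].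
rewrite ler_nat natrK; apply: leq_trans (hD _ _ _ nc (leqnn _)) _.
exact: (leq_bigmax (Ordinal (ltnSn _))).
Qed.

End PullbackInverse.

(** Makes (c) usable in the form: close images come from close points. *)
Lemma nat_bound_of_cvg_pinfty (R : realType) (rho : R -> R) :
  rho r @[r --> +oo] --> +oo ->
  forall A : R, exists D : nat, forall n : nat, rho n%:R <= A -> (n <= D)%N.
Proof.
move=> /cvgryPgt + A => /(_ A)[B [_ hB]].
exists (Num.truncn B) => n; apply: contraTT; rewrite -ltnNge -ltNge => Bn.
apply: hB; apply: lt_le_trans (truncnS_gt B) _.
by rewrite ler_nat.
Qed.

(** * Construction of the coarse inverse *)

Section CoarseInverse.
Context {R : realType} {X X' : graph}.
Context {YY : set (subgraph X)} {YY' : set (subgraph X')}.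
Context (disjYY : trivIset YY (@verts X)) (disjYY' : trivIset YY' (@verts X')).
Context (f : X -> X') (fs : subgraph X -> subgraph X').
Hypothesis ha : set_bij YY YY' fs.
Hypothesis hb : forall Y (x : X), YY Y -> (verts Y x <-> verts (fs Y) (f x)).

Lemma common_push x1 x2 : common YY' (f x1) (f x2) <-> common YY x1 x2.
Proof.
have [fsP _ fs_surj] := ha; split=> -[].
  by move=> _ /fs_surj[Y YYY <-] [v1 v2]; exists Y => //; split; apply/hb.
by move=> Y YYY [v1 v2]; exists (fs Y); [exact: fsP | split; apply/hb].
Qed.

(** The two clauses are what the coarse inverse [g] has to satisfy pointwise: compatibility with the
    subgraphs, and relative closeness of [f \o g] to the identity. *)
Lemma coarse_preimage (rho : R -> R) :
  control rho ->
  (forall Y, YY Y -> forall y' x' : X',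
    verts (fs Y) y' -> ~ verts (fs Y) x' ->
    exists2 y : X, verts Y y & (dist y' (f y))%:R <= rho (dist y' x')%:R) ->
  range f `|` \bigcup_(Y' in YY') verts Y' = [set: X'] ->
  ~ (exists2 Y', YY' Y' & forall x', verts Y' x') ->
  forall x', exists x,
    (forall Y, YY Y -> (verts (fs Y) x' <-> verts Y x)) /\
    (forall w, ~ common YY' x' w ->
      (dist x' (f x))%:R <= rho (dist x' w)%:R).
Proof.
move=> [rho0 rhoM] hrho hcover nfull x'; have [fsP fs_inj fs_surj] := ha.
have [[Y YYY vx']|nx'] := pselect (exists2 Y, YY Y & verts (fs Y) x').
  have [w0 nw0] : exists w, ~ verts (fs Y) w.
    apply: contra_notP nfull => /forallNP H; exists (fs Y); first exact: fsP.
    by move=> w; apply: contrapT.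
  pose P n := `[< exists2 w, ~ verts (fs Y) w & dist x' w = n >].
  have exP : exists n, P n by exists (dist x' w0); apply/asboolP; exists w0.
  case: (ex_minnP exP) => n /asboolP[w nw dw] nmin.
  (* Taking [w] nearest to [x'] makes one [y] serve all the [w2] at once. *)
  have [y Yy dy] := hrho Y YYY x' w vx' nw.
  exists y; split=> [Y2 YYY2|w2 nc].
    (* Disjointness on both sides and injectivity of [fs] leave [Y] as the only candidate. *)
    suff e : verts (fs Y2) x' \/ verts Y2 y -> Y2 = Y.
      by split=> v; [rewrite e //; left | rewrite e //; right].
    case=> v2; last by apply: disjYY => //; exists y.
    by apply: fs_inj; rewrite ?inE //; apply: disjYY'; [exact: fsP..|exists x'].
  apply: le_trans dy _; apply: rhoM; rewrite ?ler0n // ler_nat dw.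
  apply: nmin; apply/asboolP; exists w2 => // v2.
  by apply: nc; exists (fs Y) => //; exact: fsP.
(* Outside all the subgraphs, the covering assumption provides an exact preimage. *)
have : [set: X'] x' by [].
rewrite -hcover => -[[x _ fx]|[_ /fs_surj[Y YYY <-] v]]; last first.
  by case: nx'; exists Y.
exists x; split=> [Y YYY|w _].
  split=> v; case: nx'; exists Y => //.
  by rewrite -fx; apply/hb.
have -> : dist x' (f x) = 0%N.
  by apply/eqP; rewrite -leqn0; apply: dist_le; exists [::]; rewrite fx.
exact: rho0.
Qed.

End CoarseInverse.

(** * Assembling the inverse of the pull-back *)

Theorem proposition3p10 (R : realType) (X X' : graph)
    (connX : connected_graph X) (connX' : connected_graph X')
    (YY : set (subgraph X)) (YY' : set (subgraph X'))
    (disjYY : trivIset YY (@verts X)) (disjYY' : trivIset YY' (@verts X'))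
    (V : normedModType R)
    (f : X -> X') (fs : subgraph X -> subgraph X')
    (hf : rel_coarsely_uniform R YY YY' f fs)
    (ha : set_bij YY YY' fs)
    (hb : forall Y (x : X), YY Y -> (verts Y x <-> verts (fs Y) (f x)))
    (hc : exists rho_m : R -> R,
      [/\ control rho_m, rho_m r @[r --> +oo] --> +oo
        & forall x1 x2 : X, ~ common YY x1 x2 ->
            rho_m (dist x1 x2)%:R <= (dist (f x1) (f x2))%:R])
    (hd : exists2 rho : R -> R, control rho &
      forall Y, YY Y -> forall y' x' : X',
        verts (fs Y) y' -> ~ verts (fs Y) x' ->
        exists2 y : X, verts Y y & (dist y' (f y))%:R <= rho (dist y' x')%:R)
    (hcover : range f `|` \bigcup_(Y' in YY') verts Y' = [set: X'])
    (k : nat) :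
  bijective (pullback V connX' disjYY hf k).
Proof.
have [fsP fs_inj fs_surj] := ha.
have [[Y' YYY' Y'x]|nfull] := pselect (exists2 Y', YY' Y' & forall x', verts Y' x').
  have [Y YYY eY] := fs_surj _ YYY'.
  exists (fun=> 0) => u.
    exact: (cohomology_full _ _ _ _ YYY' Y'x).
  (* By (b), [Y] is then all of [X]. *)
  apply: (cohomology_full _ _ Y _ YYY) => x.
  by apply/(hb Y x YYY); rewrite eY.
have [rm [_ rm_oo hrm]] := hc; have [rho crho hrho] := hd.
have [_ fY [rp crp hrp]] := hf.
have [g gP] := choice
  (coarse_preimage disjYY disjYY' f fs ha hb rho crho hrho hcover nfull).
have cg x1 x2 : common YY (g x1) (g x2) <-> common YY' x1 x2.
  split=> -[].
    move=> Y YYY [v1 v2]; exists (fs Y); first exact: fsP.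
    by split; apply/(gP _).1.
  by move=> _ /fs_surj[Y YYY <-] [v1 v2]; exists Y => //; split; apply/(gP _).1.
have tfg b Y x' : YY Y -> verts (fs Y) (toggle (f \o g) b x') <-> verts (fs Y) x'.
  case: b => // YYY; rewrite /toggle /=.
  by split=> [/hb|] v; [apply/(gP _).1 => //; apply: v | apply/hb => //; apply/(gP _).1].
have ctfg b c x1 x2 : common YY' (toggle (f \o g) b x1) (toggle (f \o g) c x2) ->
    common YY' x1 x2.
  move=> -[_ /fs_surj[Y YYY <-] [v1 v2]]; exists (fs Y); first exact: fsP.
  by split; [apply/(tfg b) | apply/(tfg c)].
have near_id r b x1 x2 : ~ common YY' x1 x2 -> (dist x1 x2 <= r)%N ->
    (dist x1 (toggle (f \o g) b x1) <= Num.truncn (rho r%:R))%N.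
  move=> nc d12; case: b => /=; last first.
    by rewrite (leq_trans _ (leq0n _)) // dist_le //; exists [::].
  rewrite truncn_ge_nat ?crho.1 //.
  apply: le_trans ((gP x1).2 _ nc) _.
  by apply: crho.2; rewrite ?ler0n ?ler_nat.
have hD' r : exists D, forall b c x1 x2, ~ common YY' x1 x2 ->
    (dist x1 x2 <= r)%N ->
    (dist (toggle (f \o g) b x1) (toggle (f \o g) c x2) <= D)%N.
  (* The route runs from the image of [x1] through [x1] and [x2] to the image of [x2]; [near_id]
     bounds its outer legs by [E]. *)
  pose E := Num.truncn (rho r%:R); exists (E + (r + E))%N => b c x1 x2 nc d12.
  apply: leq_trans (dist_triangle _ x1 _ connX') _; apply: leq_add.
    by rewrite dist_sym //; exact: near_id d12.
  apply: leq_trans (dist_triangle _ x2 _ connX') _; apply: leq_add => //.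
  apply: (near_id _ _ _ x1); last by rewrite dist_sym.
  by move=> [Y ? []]; move=> ? ?; apply: nc; exists Y.
have cuf r : exists D, forall x1 x2, ~ common YY x1 x2 ->
    (dist x1 x2 <= r)%N -> (dist (f x1) (f x2) <= D)%N.
  exists (Num.truncn (rp r%:R)) => x1 x2 nc d12; rewrite truncn_ge_nat ?crp.1 //.
  case: (hrp x1 x2) => // /le_trans; apply.
  by apply: crp.2; rewrite ?ler0n ?ler_nat.
have cexp r : exists D, forall x1 x2, ~ common YY x1 x2 ->
    (dist (f x1) (f x2) <= r)%N -> (dist x1 x2 <= D)%N.
  have [D hD] := nat_bound_of_cvg_pinfty _ _ rm_oo r%:R.
  exists D => x1 x2 nc d12; apply: hD.
  by apply: le_trans (hrm _ _ nc) _; rewrite ler_nat.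
have tgf b x : f (toggle (g \o f) b x) = toggle (f \o g) b (f x) by case: b.
have hD r : exists D, forall b c x1 x2, ~ common YY x1 x2 ->
    (dist x1 x2 <= r)%N ->
    (dist (toggle (g \o f) b x1) (toggle (g \o f) c x2) <= D)%N.
  (* Apply [f], which turns [g \o f] into [f \o g], use the bound in [X'], and return to [X] by
     (c). *)
  have [D1 hD1] := cuf r; have [D2 hD2] := hD' D1; have [D3 hD3] := cexp D2.
  exists D3 => b c x1 x2 nc d12.
  have nc' : ~ common YY' (f x1) (f x2) by move/(common_push f fs ha hb).
  apply: hD3; last by rewrite !tgf; apply: hD2 => //; exact: hD1.
  by move/(common_push f fs ha hb); rewrite !tgf => /ctfg.
have /choice[gs gsP] : forall Y', exists Y, YY' Y' -> YY Y /\ fs Y = Y'.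
  (* The empty subgraph serves as default value of [gs] outside [YY']. *)
  pose Y0 : subgraph X := @Subgraph X set0 (fun _ _ => false) (fun _ _ => erefl)
    (fun u v H => match Bool.diff_false_true H with end)
    (fun u v H => match Bool.diff_false_true H with end).
  move=> Y'; have [/fs_surj[Y ? ?]|?] := pselect (YY' Y'); first by exists Y.
  by exists Y0.
have hg : rel_coarsely_uniform R YY' YY g gs.
  apply: rel_coarsely_uniform_nat => [Y'|Y' YYY' _ [x' v <-]|r].
  - by move/gsP => [].
  - by have [YYg eg] := gsP _ YYY'; apply/(gP _).1 => //; rewrite eg.
  (* The map [f \o g] keeps distances under control, and (c) removes the [f]. *)
  have [D1 hD1] := hD' r; have [D2 hD2] := cexp D1.
  exists D2 => x1 x2 nc d12; apply: hD2; first by move/cg.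
  exact: (hD1 true true).
(* The first cancellation concerns [f \o g], the second [g \o f]. *)
exists (pullback V connX disjYY' hg k).
  apply: pullbackK; last exact: hD'.
  by move=> _ x' /fs_surj[Y YYY <-] v; apply/(tfg true).
apply: pullbackK; last exact: hD.
by move=> Y x YYY v; apply/(gP _).1 => //; apply/hb.
Qed.
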